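(* Let $(H,\mu)$ be a (commutative) Hilbertian Frobenius algebra. Then for each $u\in H$, the operator $M_u$ is normal. In particular, $J(H,\mu)=A(H,\mu)$.
   Context: All Hilbert spaces are complex; $\hat{\otimes}_2$ is the Hilbert space tensor product; $f^{\dagger}$ is the Hilbert adjoint of a bounded linear map $f$. A Hilbertian algebra is a pair $(H,\mu)$ with $H$ a Hilbert space and $\mu\colon H\hat{\otimes}_2H\to H$ a bounded linear map which is associative and commutative (no unit is assumed); write $xy:=\mu(x\otimes y)$. With $\alpha\colon (H\hat{\otimes}_2H)\hat{\otimes}_2H\to H\hat{\otimes}_2(H\hat{\otimes}_2H)$ the canonical unitary, $(H,\mu)$ is a Hilbertian Frobenius algebra (or semigroup) when moreover $(\mu\hat{\otimes}_2 id)\circ\alpha^{-1}\circ(id\hat{\otimes}_2\mu^{\dagger})=\mu^{\dagger}\circ\mu=(id\hat{\otimes}_2\mu)\circ\alpha\circ(\mu^{\dagger}\hat{\otimes}_2 id)$. For $u\in H$, $M_u\colon H\to H$ is $M_u(v):=uv$. A bounded operator $f$ on $H$ is normal when $f\circ f^{\dagger}=f^{\dagger}\circ f$. $J(H,\mu)$ is the Jacobson radical of the commutative Banach algebra $H$ with product $(x,y)\mapsto xy$ (and an equivalent submultiplicative norm), i.e. the intersection of its maximal modular ideals, equivalently of the kernels of its non-zero algebra maps to $\mathbb{C}$ (so $J(H,\mu)=H$ if there are none). $A(H,\mu)=\{u\in H\colon uv=0\text{ for all }v\in H\}$. *)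

(* Defs.v *)
From HB Require Import structures.
From mathcomp Require Import all_boot all_order all_algebra.
From mathcomp Require Import complex.
From mathcomp Require Import all_classical all_reals all_analysis.

Set Implicit Arguments.
Unset Strict Implicit.
Unset Printing Implicit Defensive.

Import Order.TTheory GRing.Theory Num.Theory.
Import numFieldNormedType.Exports.

Local Open Scope classical_set_scope.
Local Open Scope ring_scope.

(* [{dot H for Num.conj}] forms are positive definite, linear in the first
   variable and conjugate-linear in the second. *)
HB.mixin Record CompleteNormedModule_isHilbert (R : realType) H
    of CompleteNormedModule R[i] H := {
  inner : {dot H for @Num.conj R[i]};
  innerxx : forall x : H, inner x x = `|x| ^+ 2
}.

#[short(type="hilbertType")]
HB.structure Definition Hilbert (R : realType) :=
  { H of CompleteNormedModule R[i] H & CompleteNormedModule_isHilbert R H }.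

Section BoundedOperators.
Variable R : realType.
Implicit Types H K : hilbertType R.

Definition bounded_linear H K (f : H -> K) : Prop :=
  linear f /\ exists k : R[i], forall x, `|f x| <= k * `|x|.

(* For [f] bounded linear, the set below is a singleton by the Riesz
   representation theorem. *)
Definition adjoint H K (f : H -> K) : K -> H :=
  get [set g : K -> H |
    bounded_linear g /\ forall x y, inner (f x) y = inner x (g y)].

Definition normal_operator H (f : H -> H) : Prop :=
  bounded_linear f /\ f \o adjoint f = adjoint f \o f.

End BoundedOperators.

(* The Hilbert tensor product is only defined up to a canonical unitary; this
   is the structure that determines it: a Hilbert space with a bilinear map
   multiplicative for inner products and whose range spans a dense subspace.
   (No scalars are needed in the span: they are absorbed by the [x i].) *)
Record hilbertTensor (R : realType) (H K : hilbertType R) := HilbertTensor {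
  tensor_space :> hilbertType R;
  tens : {bilinear H -> K -> tensor_space};
  inner_tens : forall x x' y y',
    inner (tens x y) (tens x' y') = inner x x' * inner y y';
  tens_total : dense [set w | exists n (x : 'I_n -> H) (y : 'I_n -> K),
    w = \sum_(i < n) tens (x i) (y i)]
}.

(* [get] selects the unique bounded linear map with the given values on
   elementary tensors; it exists for [f] and [g] bounded linear. *)
Definition tensor_map (R : realType) (H K H' K' : hilbertType R)
    (T : hilbertTensor H K) (T' : hilbertTensor H' K')
    (f : H -> H') (g : K -> K') : T -> T' :=
  get [set h : T -> T' |
    bounded_linear h /\ forall x y, h (tens T x y) = tens T' (f x) (g y)].
Arguments tensor_map {R H K H' K'} T T' f g.

Definition tensor_assoc (R : realType) (H K L : hilbertType R)
    (HK : hilbertTensor H K) (KL : hilbertTensor K L)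
    (T : hilbertTensor HK L) (T' : hilbertTensor H KL) : T -> T' :=
  get [set a : T -> T' | bounded_linear a /\
    forall x y z, a (tens T (tens HK x y) z) = tens T' x (tens KL y z)].
Arguments tensor_assoc {R H K L HK KL} T T'.

(* [tensor_assoc] is unitary, hence bijective. *)
Definition tensor_assoc_inv (R : realType) (H K L : hilbertType R)
    (HK : hilbertTensor H K) (KL : hilbertTensor K L)
    (T : hilbertTensor HK L) (T' : hilbertTensor H KL) : T' -> T :=
  get [set b : T' -> T |
    cancel (tensor_assoc T T') b /\ cancel b (tensor_assoc T T')].
Arguments tensor_assoc_inv {R H K L HK KL} T T'.

Section HilbertianAlgebra.
Variables (R : realType) (H : hilbertType R) (HH : hilbertTensor H H).
Variable mu : HH -> H.

Definition hmul (x y : H) : H := mu (tens HH x y).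

Record hilbertian_algebra : Prop := {
  hmul_bounded : bounded_linear mu;
  hmulA : associative hmul;
  hmulC : commutative hmul
}.

Record hilbertian_frobenius_algebra
    (HHl : hilbertTensor HH H) (HHr : hilbertTensor H HH) : Prop := {
  frobenius_algebra : hilbertian_algebra;
  frobenius_left :
    tensor_map HHl HH mu (@id H) \o tensor_assoc_inv HHl HHr
      \o tensor_map HH HHr (@id H) (adjoint mu)
    = adjoint mu \o mu;
  frobenius_right :
    adjoint mu \o mu
    = tensor_map HHr HH (@id H) mu \o tensor_assoc HHl HHr
      \o tensor_map HH HHl (adjoint mu) (@id H)
}.

Definition annihilator : set H := [set u | forall v, hmul u v = 0].

Record algebra_ideal (I : set H) : Prop := {
  ideal0 : I 0;
  ideal_linear : forall (a : R[i]) x y, I x -> I y -> I (a *: x + y);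
  ideal_mul : forall x y, I y -> I (hmul x y)
}.

(* Two-sided and one-sided notions agree since [hmul] is commutative. *)
Definition modular_ideal (I : set H) : Prop :=
  algebra_ideal I /\ exists e, forall x, I (x - hmul e x).

Definition maximal_modular_ideal (I : set H) : Prop :=
  [/\ modular_ideal I, I <> setT &
      forall J, algebra_ideal J -> I `<=` J -> J = I \/ J = setT].

(* The whole space when there is no maximal modular ideal. *)
Definition jacobson_radical : set H :=
  [set x | forall I, maximal_modular_ideal I -> I x].

End HilbertianAlgebra.

(* Main.v *)
Require Import Defs.
From HB Require Import structures.
From mathcomp Require Import all_boot all_order all_algebra.
From mathcomp Require Import complex.
From mathcomp Require Import all_classical all_reals all_analysis.
From mathcomp Require Import ring lra.

(** Write [x y] for the product, [M_x] for multiplication by [x] and [delta]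
for the adjoint of [mu].  One Frobenius equation suffices: evaluated at
[x (x) y] it says that [delta (x y)] is the image of [delta x] under
[id (x) M_y].  Pairing with [u (x) z], the left side becomes [<x y, u z>] and
the right side [<delta x, u (x) M_y^dag z>], which is [<x, u (M_y^dag z)>]; so
[M_y^dag (u z) = u (M_y^dag z)]: the adjoint of a multiplication is a module
map ([frobenius_adjM]).  Taking [u = y] gives normality.

For the radical, the annihilator lies in every maximal modular ideal because
[u - e u] does and [e u = 0].  Conversely let [x] be in the radical and put
[p = M_x^dag x].  By the module property [M_p = M_x^dag M_x], which is
self-adjoint, and [p p = x (M_x^dag p)] is again in the radical.  Zorn's lemma
shows that every multiple of a radical element is quasi-regular
([radical_quasiregular]), so [1 - lambda M_p ^ 2] is bounded below for all
scalars [lambda].  For self-adjoint [M_p] this contradicts the optimality of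
the best constant in [|p v|^2 <= c |v|^2], unless [c = 0]
([radical_selfadjoint_sqr]).  Hence [M_x^dag M_x = 0] and [M_x = 0].

The tensor maps, the associator and the adjoints in the Frobenius equation are
specified by their properties alone, so their existence has to be established.
Adjoints come from the Riesz representation theorem, by minimizing a quadratic
functional.  The maps out of a tensor product come from [bounded_extension]:
prescribed values on a family with dense sums extend as soon as the sums are
bounded accordingly.  For the associator both families have the same inner
products; for [f (x) id] the bound is [ampliation_bound], proved by splitting
off one vector of the second factor at a time, orthogonally. *)

Set Implicit Arguments.
Unset Strict Implicit.
Unset Printing Implicit Defensive.

Import Order.TTheory GRing.Theory Num.Theory.
Import numFieldNormedType.Exports.

Local Open Scope classical_set_scope.
Local Open Scope complex_scope.
Local Open Scope ring_scope.

(** * Inner products and real-valued norms *)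

Section InnerProduct.
Variables (R : realType) (H : hilbertType R).
Implicit Types x y z : H.

Lemma inner_conj x y : inner x y = (inner y x)^*%C.
Proof. by rewrite hermC mul1r. Qed.

Lemma innerPl a x y z : inner (a *: x + y) z = a * inner x z + inner y z.
Proof. by rewrite linearPl. Qed.

Lemma innerDl x y z : inner (x + y) z = inner x z + inner y z.
Proof. exact: linearDl. Qed.

Lemma innerBl x y z : inner (x - y) z = inner x z - inner y z.
Proof. exact: linearBl. Qed.

Lemma innerZl a x y : inner (a *: x) y = a * inner x y.
Proof. exact: linearZl_LR. Qed.

Lemma innerDr x y z : inner x (y + z) = inner x y + inner x z.
Proof. exact: linearDr. Qed.

Lemma innerBr x y z : inner x (y - z) = inner x y - inner x z.
Proof. exact: linearBr. Qed.

Lemma innerZr a x y : inner x (a *: y) = a^*%C * inner x y.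
Proof. exact: linearZr_LR. Qed.

Lemma inner0r x : inner x 0 = 0.
Proof. exact: linear0r. Qed.

Lemma inner_eq0 x : inner x x = 0 -> x = 0.
Proof. by move/eqP; rewrite dnorm_eq0 => /eqP. Qed.

Lemma inner_eqr x y : (forall z, inner z x = inner z y) -> x = y.
Proof.
move=> E; apply/eqP; rewrite -subr_eq0; apply/eqP/inner_eq0.
by rewrite innerBr E subrr.
Qed.

(** When [y = 0] the inverse is [0], so the coefficient is [0] and the rest is
[x]: the orthogonal splitting of [x] along [y] needs no case distinction. *)
Definition proj_coef x y : R[i] := inner x y / inner y y.

Definition proj_rest x y : H := x - proj_coef x y *: y.

Lemma proj_split x y : x = proj_coef x y *: y + proj_rest x y.
Proof. by rewrite addrC subrK. Qed.

Lemma inner_proj_rest x y : inner (proj_rest x y) y = 0.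
Proof.
rewrite innerBl innerZl /proj_coef.
have [->|y0] := eqVneq y 0; first by rewrite !inner0r mulr0 subr0.
by rewrite divfK ?subrr // dnorm_eq0.
Qed.

Lemma normD_orthogonal x y :
  inner x y = 0 -> `|x + y| ^+ 2 = `|x| ^+ 2 + `|y| ^+ 2.
Proof. by move=> xy0; rewrite -!innerxx hnormDd. Qed.

Lemma cauchy_schwarz x y : `|inner x y| <= `|x| * `|y|.
Proof.
rewrite -(@ler_pXn2r _ 2) ?nnegrE ?mulr_ge0 //.
have := inner_proj_rest x y; have := proj_split x y.
move: (proj_coef x y) (proj_rest x y) => c r xE ry.
have cy_r : inner (c *: y) r = 0.
  by rewrite inner_conj innerZr ry mulr0 conjc0.
rewrite xE innerDl ry addr0 innerZl innerxx exprMn normD_orthogonal //.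
rewrite [X in _ <= X]mulrDl (normrM c) (normrZ c y) normrX normr_id !exprMn.
by rewrite mulrA lerDl mulr_ge0 // exprn_ge0.
Qed.

End InnerProduct.

(** The rewriting rules of bundled linear maps, for maps that are only known
to satisfy the predicate [linear]. *)
Section LinearProp.
Variables (K : nzRingType) (U V : lmodType K) (f : U -> V).
Hypothesis lf : linear f.

Let F : {linear U -> V} := HB.pack f (GRing.isLinear.Build K U V *:%R f lf).

Lemma lin0 : f 0 = 0. Proof. exact: (linear0 F). Qed.
Lemma linD x y : f (x + y) = f x + f y. Proof. exact: (linearD F). Qed.
Lemma linB x y : f (x - y) = f x - f y. Proof. exact: (linearB F). Qed.
Lemma linZ a x : f (a *: x) = a *: f x. Proof. exact: (linearZ_LR F). Qed.
Lemma lin_sum (I : Type) (s : seq I) (x : I -> U) :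
  f (\sum_(i <- s) x i) = \sum_(i <- s) f (x i).
Proof. exact: (linear_sum F). Qed.

End LinearProp.

Section RealNorm.
Variables (R : realType).

(** Norms of the spaces at hand take values in [R[i]], whose order is partial;
their real part allows the use of infima and of linear real arithmetic. *)
Definition rnorm (V : normedZmodType R[i]) (x : V) : R := complex.Re `|x|.

Lemma rnormE (V : normedZmodType R[i]) (x : V) : `|x| = (rnorm x)%:C.
Proof. by rewrite RRe_real // normr_real. Qed.

Lemma rnorm_ge0 (V : normedZmodType R[i]) (x : V) : 0 <= rnorm x.
Proof. by rewrite -ler0c -rnormE. Qed.

Lemma rnormD (V : normedZmodType R[i]) (x y : V) :
  rnorm (x + y) <= rnorm x + rnorm y.
Proof. by rewrite -lecR rmorphD /= -!rnormE ler_normD. Qed.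

Lemma rnormBC (V : normedZmodType R[i]) (x y : V) :
  rnorm (x - y) = rnorm (y - x).
Proof. by rewrite /rnorm distrC. Qed.

Lemma rnorm0 (V : normedZmodType R[i]) : rnorm (0 : V) = 0.
Proof. by rewrite /rnorm normr0. Qed.

Lemma rnorm0_eq0 (V : normedZmodType R[i]) (x : V) : rnorm x = 0 -> x = 0.
Proof. by move=> x0; apply/normr0_eq0; rewrite rnormE x0. Qed.

Lemma rnormZ (V : normedModType R[i]) (a : R[i]) (x : V) :
  rnorm (a *: x) = rnorm a * rnorm x.
Proof. by apply: complexI; rewrite rmorphM /= -!rnormE normrZ. Qed.

Lemma rnorm_sqr (H : hilbertType R) (x : H) :
  complex.Re (inner x x) = rnorm x ^+ 2.
Proof. by rewrite innerxx rnormE -rmorphXn. Qed.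

Lemma rnorm_sqrD_scale (H : hilbertType R) (x v : H) (t : R) :
  rnorm (x + t%:C *: v) ^+ 2 =
  rnorm x ^+ 2 + 2 * t * complex.Re (inner x v) + t ^+ 2 * rnorm v ^+ 2.
Proof.
rewrite -!rnorm_sqr innerDl innerZl !innerDr !innerZr conjc_real.
rewrite (inner_conj v x).
case: (inner x v) (inner x x) (inner v v) => [a b] [c d] [e f].
by rewrite /=; ring.
Qed.

Lemma Re_le_rnorm (a : R[i]) : `|complex.Re a| <= rnorm a.
Proof. by rewrite -lecR -rnormE; exact: normc_ge_Re. Qed.

Lemma rnorm_inner (H : hilbertType R) (x y : H) :
  rnorm (inner x y) <= rnorm x * rnorm y.
Proof. by rewrite -lecR rmorphM /= -!rnormE cauchy_schwarz. Qed.

Lemma Re_inner_le (H : hilbertType R) (x y : H) :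
  `|complex.Re (inner x y)| <= rnorm x * rnorm y.
Proof. exact: le_trans (Re_le_rnorm _) (rnorm_inner x y). Qed.

Lemma Re_innerC (H : hilbertType R) (x y : H) :
  complex.Re (inner x y) = complex.Re (inner y x).
Proof. by rewrite inner_conj; case: (inner y x). Qed.

(** The complex constant of [bounded_linear] may be replaced by a positive real
one, by which one can divide. *)
Lemma bounded_linear_rnorm (H K : hilbertType R) (f : H -> K) :
  bounded_linear f ->
  exists2 k : R, 0 < k & forall x, rnorm (f x) <= k * rnorm x.
Proof.
move=> [_ [k fk]]; exists (rnorm k + 1) => [|x].
  by rewrite ltr_wpDl // rnorm_ge0.
apply: (@le_trans _ _ (rnorm k * rnorm x)); last first.
  by rewrite ler_wpM2r ?rnorm_ge0 // lerDl.
rewrite -lecR rmorphM /= -!rnormE.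
rewrite (le_trans (fk x)) // -{2}(normr_id x) -normrM ger0_norm //.
by rewrite (le_trans _ (fk x)).
Qed.

Lemma rnorm_bounded_linear (H K : hilbertType R) (f : H -> K) (k : R) :
  linear f -> (forall x, rnorm (f x) <= k * rnorm x) -> bounded_linear f.
Proof.
by move=> lf fk; split=> //; exists k%:C => x; rewrite !rnormE -rmorphM lecR.
Qed.

Lemma ball_rnorm (V : normedModType R[i]) (x y : V) (d : R) :
  ball x d%:C y <-> rnorm (x - y) < d.
Proof. by rewrite -ball_normE /ball_ /= rnormE ltcR. Qed.

Lemma gt0_Re (e : R[i]) : 0 < e -> 0 < complex.Re e /\ e = (complex.Re e)%:C.
Proof. by case: e => a b; rewrite ltcE /= => /andP[/eqP -> ->]. Qed.

(** Completeness in the form in which both minimizing families and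
approximations of a value are used: no choice of a sequence is needed, since
the family itself generates a Cauchy filter. *)
Lemma complete_family (V : completeNormedModType R[i]) (A : R -> set V) :
  (forall e, 0 < e -> A e !=set0) ->
  (forall e e', e <= e' -> A e `<=` A e') ->
  (forall d, 0 < d ->
    exists2 e, 0 < e & forall x y, A e x -> A e y -> rnorm (x - y) < d) ->
  exists z, forall e d, 0 < e -> 0 < d -> exists2 x, A e x & rnorm (z - x) < d.
Proof.
move=> A0 Amono Asmall; pose F := filter_from [set e : R | 0 < e] A.
have FF : ProperFilter F.
  apply: filter_from_proper => //; apply: filter_from_filter.
    by exists 1 => /=.
  move=> e e' /= e0 e0'; exists (Num.min e e') => /=.
    by rewrite lt_min e0.
  by move=> x Ax; split; apply: Amono Ax; rewrite ge_min lexx ?orbT.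
have /cauchy_cvg : cauchy F.
  apply: cauchy_exP => eps /gt0_Re[d0 ->].
  have [e e0 Ae] := Asmall _ d0; have [x Ax] := A0 _ e0.
  by exists x; exists e => // y Ay; apply/ball_rnorm/Ae.
move=> /cvg_ex[z Fz]; exists z => e d e0 d0.
have d0' : 0 < d%:C by rewrite ltcR.
have [e' /= e0' Ae'] : F (ball z d%:C) by apply: Fz; exact: nbhsx_ballx.
have [x Ax] := A0 (Num.min e e') (ltac:(by rewrite lt_min e0)).
exists x; first by apply: Amono Ax; rewrite ge_min lexx.
by apply/ball_rnorm/Ae'; apply: Amono Ax; rewrite ge_min lexx orbT.
Qed.

End RealNorm.

(** * Riesz representation and adjoints *)

Section Riesz.
Variables (R : realType) (H : hilbertType R) (phi : H -> R[i]) (k : R).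
Hypothesis phiP : forall a x y, phi (a *: x + y) = a * phi x + phi y.
Hypothesis phik : forall x, rnorm (phi x) <= k * rnorm x.

(** A minimizer [z] of [J] represents [phi], since [D z v] is half the
derivative of [J] at [z] in the direction [v]. *)
Let J x := rnorm x ^+ 2 - 2 * complex.Re (phi x).
Let D x v := complex.Re (inner x v) - complex.Re (phi v).

Let J_expand x v t :
  J (x + t%:C *: v) = J x + 2 * t * D x v + t ^+ 2 * rnorm v ^+ 2.
Proof.
rewrite /J /D rnorm_sqrD_scale (addrC x) phiP.
by case: (phi x) (phi v) => [a b] [c d] /=; ring.
Qed.

Let J_lower x : - k ^+ 2 <= J x.
Proof.
have := le_trans (Re_le_rnorm _) (phik x); rewrite ler_norml /J => /andP[_].
by have := sqr_ge0 (rnorm x - k); nra.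
Qed.

Let m := inf (range J).

Let J_has_inf : has_inf (range J).
Proof. by split; [exists (J 0), 0|exists (- k ^+ 2) => _ [x _ <-]]. Qed.

Let m_le x : m <= J x.
Proof. by apply: ge_inf; [exact: (proj2 J_has_inf)|exists x]. Qed.

(** The parallelogram argument: the midpoint of two near-minimizers cannot be
below the infimum. *)
Let near_min_close e x y :
  J x < m + e -> J y < m + e -> rnorm (x - y) ^+ 2 < 4 * e.
Proof.
move=> Jx Jy; have := J_expand x (y - x) 1; rewrite scale1r addrC subrK.
have := m_le (x + (2^-1)%:C *: (y - x)); rewrite J_expand (rnormBC x y).
move: (D x _) (rnorm (y - x) ^+ 2) => d N mE yE.
have -> : N = 2 * (J x + J y - 2 * (J x + 2 / 2 * d + 2^-1 ^+ 2 * N)).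
  by rewrite yE; field.
by lra.
Qed.

(** A quantitative critical point condition at near-minimizers; passing to the
limit in it avoids the continuity of [J]. *)
Let near_min_critical e x v :
  J x < m + e -> D x v ^+ 2 <= e * (rnorm v ^+ 2 + 1).
Proof.
move=> Jx; set N := rnorm v ^+ 2; have N0 : 0 <= N by exact: sqr_ge0.
set d := D x v; set s := (N + 1)^-1.
have sN : s * (N + 1) = 1 by rewrite mulVf // gt_eqF // ltr_wpDl.
have s0 : 0 < s by rewrite invr_gt0 ltr_wpDl.
have : d ^+ 2 * s <= e.
  (* The best step is [- d / N]; the denominator [N + 1] cannot vanish. *)
  have := m_le (x + (- d * s)%:C *: v); rewrite J_expand -/N -/d -addrA.
  have -> : 2 * (- d * s) * d + (- d * s) ^+ 2 * N =
            - d ^+ 2 * s - (d * s) ^+ 2.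
    have -> : (- d * s) ^+ 2 * N = d ^+ 2 * s * (s * (N + 1) - s) by ring.
    by rewrite sN; ring.
  by have := sqr_ge0 (d * s); nra.
move=> ds_le; have -> : d ^+ 2 = d ^+ 2 * s * (N + 1).
  by rewrite -mulrA sN mulr1.
by rewrite ler_wpM2r // addr_ge0.
Qed.

Lemma riesz_representation : exists z, forall x, phi x = inner x z.
Proof.
have [||d d0|z zP] := @complete_family _ H (fun e => [set x | J x < m + e]).
- move=> e e0; have [_ [x _ <-] Jx] := inf_adherent e0 J_has_inf.
  by exists x.
- by move=> e e' ee' x /= /lt_le_trans; apply; rewrite lerD2l.
- exists (d ^+ 2 / 4) => [|x y /= Jx Jy].
    by rewrite divr_gt0 // exprn_gt0.
  rewrite -(@ltr_pXn2r _ 2) ?nnegrE ?rnorm_ge0 ?(ltW d0) //.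
  by have := near_min_close Jx Jy; rewrite mulrC divfK.
have Dz v : D z v = 0.
  apply/eqP; rewrite -normr_le0 leNgt; apply/negP => a0.
  set a := `|D z v| in a0; set n := rnorm v.
  have n0 : 0 <= n by exact: rnorm_ge0.
  have [||x /= Jx zx] := zP ((a / 2) ^+ 2 / (n ^+ 2 + 1)) (a / 2 / (n + 1)).
  - by rewrite divr_gt0 ?exprn_gt0 ?divr_gt0 // ltr_wpDl // sqr_ge0.
  - by rewrite !divr_gt0 // ltr_wpDl.
  have := near_min_critical v Jx; rewrite divfK ?gt_eqF ?ltr_wpDl ?sqr_ge0 //.
  rewrite -[D x v ^+ 2]real_normK ?num_real //.
  rewrite ler_pXn2r ?nnegrE ?divr_ge0 ?(ltW a0) //.
  have : `|D z v - D x v| < a / 2.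
    rewrite /D opprB addrA subrK.
    have -> : complex.Re (inner z v) - complex.Re (inner x v) =
              complex.Re (inner (z - x) v).
      by rewrite innerBl; case: (inner z v) (inner x v) => [? ?] [].
    apply: le_lt_trans (Re_inner_le _ _) _; rewrite -/n.
    rewrite ltr_pdivlMr ?ltr_wpDl // in zx.
    by apply: le_lt_trans zx; rewrite ler_wpM2l ?rnorm_ge0 // lerDl.
  have := ler_normD (D z v - D x v) (D x v); rewrite subrK -/a; lra.
have phiRe v : complex.Re (phi v) = complex.Re (inner v z).
  by rewrite Re_innerC; apply/esym/eqP; rewrite -subr_eq0 -/(D z v) Dz.
(* The imaginary part of [phi v] is, up to sign, the real part of
   [phi (i v)]. *)
exists z => v; have := phiRe v; have := phiRe ('i%C *: v).
have := phiP 'i%C v 0; rewrite addr0 => ->.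
have -> : phi 0 = 0.
  by have := phiP (-1) 0 0; rewrite scaler0 addr0 mulN1r addNr.
rewrite innerZl; case: (phi v) (inner v z) => [a b] [c d] /=.
by rewrite !mul0r !mul1r !sub0r addr0 => /oppr_inj -> ->.
Qed.

End Riesz.

Lemma adjoint_exists (R : realType) (H K : hilbertType R) (f : H -> K) :
  bounded_linear f -> exists g : K -> H,
  bounded_linear g /\ forall x y, inner (f x) y = inner x (g y).
Proof.
move=> bf; have [k k0 fk] := bounded_linear_rnorm bf; have [lf _] := bf.
have /choice[g gE] : forall y, exists z, forall x, inner (f x) y = inner x z.
  move=> y; apply: (@riesz_representation _ _ (fun x => inner (f x) y)
    (k * rnorm y)).
    by move=> a x x'; rewrite lf innerPl.
  move=> x; rewrite mulrAC; apply: le_trans (rnorm_inner _ _) _.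
  by rewrite ler_wpM2r ?rnorm_ge0.
exists g; split; last by move=> x y; exact: gE.
apply: (@rnorm_bounded_linear _ _ _ _ k) => [a x y|y].
  by apply: inner_eqr => z; rewrite -gE !innerDr !innerZr !gE.
have [->|gy0] := eqVneq (rnorm (g y)) 0.
  by rewrite mulr_ge0 ?rnorm_ge0 ?ltW.
(* [|g y|^2 = <f (g y), y> <= k |g y| |y|], divided by [|g y|] *)
have gy : 0 < rnorm (g y) by rewrite lt_def gy0 rnorm_ge0.
rewrite -(ler_pM2l gy) -expr2 -rnorm_sqr -gE.
apply: le_trans (ler_norm _) (le_trans (Re_inner_le _ _) _).
by rewrite mulrCA mulrA ler_wpM2r ?rnorm_ge0.
Qed.

Lemma adjointP (R : realType) (H K : hilbertType R) (f : H -> K) :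
  bounded_linear f ->
  bounded_linear (adjoint f) /\
  forall x y, inner (f x) y = inner x (adjoint f y).
Proof. by move=> /adjoint_exists; exact: getPex. Qed.

(** * Extension of bounded linear maps from families with dense sums *)

Section Extension.
Variables (R : realType) (T K : hilbertType R) (I : Type).
Variables (e : I -> T) (b : I -> K) (k : R).
Hypothesis k0 : 0 < k.
Hypothesis scaled : forall a i, exists j, a *: e i = e j /\ a *: b i = b j.
Hypothesis sum_le : forall s : seq I,
  rnorm (\sum_(i <- s) b i) <= k * rnorm (\sum_(i <- s) e i).
Hypothesis e_total : forall w d, 0 < d ->
  exists s : seq I, rnorm (w - \sum_(i <- s) e i) < d.

Let comb a s s' : exists s'',
  a *: (\sum_(i <- s) e i) + \sum_(i <- s') e i = \sum_(i <- s'') e i /\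
  a *: (\sum_(i <- s) b i) + \sum_(i <- s') b i = \sum_(i <- s'') b i.
Proof.
elim: s => [|i s [s'' [eE bE]]].
  by exists s'; rewrite !big_nil !scaler0 !add0r.
have [j [ej bj]] := scaled a i; exists (j :: s'').
by rewrite !big_cons !scalerDr -!addrA eE bE ej bj.
Qed.

Let sum_close s s' : rnorm (\sum_(i <- s) b i - \sum_(i <- s') b i) <=
  k * rnorm (\sum_(i <- s) e i - \sum_(i <- s') e i).
Proof.
rewrite rnormBC (rnormBC (\sum_(i <- s) e i)).
have [s'' [eE bE]] := comb (-1) s s'.
rewrite !scaleN1r addrC in eE; rewrite !scaleN1r addrC in bE.
by rewrite eE bE.
Qed.

(** The closure of the partial graph; the extension is obtained by showing
that it is the graph of a total bounded linear map. *)
Let graph w q := forall d, 0 < d -> exists s : seq I,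
  rnorm (w - \sum_(i <- s) e i) < d /\ rnorm (q - \sum_(i <- s) b i) < d.

Let graph_total w : exists q, graph w q.
Proof.
have [|||q qP] := @complete_family _ K (fun d => [set q | exists2 s : seq I,
    rnorm (w - \sum_(i <- s) e i) < d & q = \sum_(i <- s) b i]).
- by move=> d d0; have [s ws] := e_total w d0; exists (\sum_(i <- s) b i), s.
- by move=> d d' dd' q [s /lt_le_trans ws ->]; exists s => //; exact: ws.
- move=> d d0; exists (d / (2 * k)); first by rewrite divr_gt0 // mulr_gt0.
  move=> _ _ [s ws ->] [s' ws' ->]; apply: le_lt_trans (sum_close _ _) _.
  have := rnormD (\sum_(i <- s) e i - w) (w - \sum_(i <- s') e i).
  rewrite addrA subrK (rnormBC _ w) => ss'.
  rewrite mulrC -ltr_pdivlMr //; apply: le_lt_trans ss' _.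
  have -> : d / k = d / (2 * k) + d / (2 * k) by field; rewrite gt_eqF.
  exact: ltrD.
by exists q => d d0; have [_ [s ws ->] qs] := qP d d d0 d0; exists s.
Qed.

Let graph_linear a w w' q q' :
  graph w q -> graph w' q' -> graph (a *: w + w') (a *: q + q').
Proof.
move=> wq wq' d d0; have a0 : 0 < rnorm a + 1 by rewrite ltr_wpDl ?rnorm_ge0.
have d0' : 0 < d / (rnorm a + 1) by rewrite divr_gt0.
have [s [ws qs]] := wq _ d0'; have [s' [ws' qs']] := wq' _ d0'.
have dE : d = rnorm a * (d / (rnorm a + 1)) + d / (rnorm a + 1).
  by field; rewrite gt_eqF.
have [s'' [eE bE]] := comb a s s'; exists s''; rewrite -eE -bE.
split; rewrite opprD addrACA -scalerBr; apply: le_lt_trans (rnormD _ _) _;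
  by rewrite rnormZ [ltRHS]dE ler_ltD // ler_wpM2l ?rnorm_ge0 // ltW.
Qed.

Let graph_bound w q : graph w q -> rnorm q <= k * rnorm w.
Proof.
move=> wq; apply/ler_addgt0Pr => d d0.
have k1 : 0 < k + 1 by rewrite ltr_wpDl // ltW.
have [|s [ws qs]] := wq (d / (k + 1)); first by rewrite divr_gt0.
have := rnormD (q - \sum_(i <- s) b i) (\sum_(i <- s) b i).
rewrite subrK => /le_trans; apply.
have := rnormD (\sum_(i <- s) e i - w) w; rewrite subrK rnormBC => es.
have := le_trans (sum_le s) (ler_wpM2l (ltW k0) es).
have := ler_wpM2l (ltW k0) (ltW ws).
have dE : d = k * (d / (k + 1)) + d / (k + 1) by field; rewrite gt_eqF.
by move: qs; lra.
Qed.

Let graph_functional w q q' : graph w q -> graph w q' -> q = q'.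
Proof.
move=> wq wq'; have := graph_bound (graph_linear (-1) wq' wq).
rewrite !scaleN1r addNr rnorm0 mulr0 addrC => qq'.
apply/eqP; rewrite -subr_eq0; apply/eqP/rnorm0_eq0/le_anti.
by rewrite qq' rnorm_ge0.
Qed.

(** Scalars are absorbed by the indices ([scaled]), as for elementary tensors,
so that plain sums already form a subspace. *)
Lemma bounded_extension :
  exists h : T -> K, bounded_linear h /\ forall i, h (e i) = b i.
Proof.
have [h hP] := choice graph_total; exists h; split.
  apply: (@rnorm_bounded_linear _ _ _ _ k) => [a w w'|w]; last first.
    exact: graph_bound.
  by apply: (graph_functional (hP _)); apply: graph_linear.
move=> i; apply: (graph_functional (hP _)) => d d0; exists [:: i].
by rewrite !big_seq1 !subrr !rnorm0.
Qed.

End Extension.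

(** * Tensor products of bounded maps *)

Section Multiplicative.
Variable R : realType.
Implicit Types H K T : hilbertType R.

(** Isolated from [hilbertTensor] because it is symmetric in the two factors:
results on the first factor transfer to the second by flipping, without
building the tensor product with exchanged factors. *)
Definition inner_multiplicative H K T (t : H -> K -> T) := forall x x' y y',
  inner (t x y) (t x' y') = inner x x' * inner y y'.

Lemma inner_multiplicative_flip H K T (t : H -> K -> T) :
  inner_multiplicative t -> inner_multiplicative (fun y x => t x y).
Proof. by move=> tm x x' y y'; rewrite tm mulrC. Qed.

(** The defect of linearity [d] is a combination of vectors [t z y], to all of
which it is orthogonal; hence [<d, d> = 0]. *)
Lemma inner_multiplicative_linear H K T (t : H -> K -> T) y :
  inner_multiplicative t -> linear (t^~ y).
Proof.
move=> tm a x x'; apply/eqP; rewrite -subr_eq0; apply/eqP/inner_eq0.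
set d := _ - _; have dt z : inner d (t z y) = 0.
  by rewrite /d innerBl innerPl !tm innerPl; ring.
by rewrite {2}/d innerBr innerDr innerZr !dt mulr0 addr0 subr0.
Qed.

Lemma inner_suml H (I : Type) (s : seq I) (F : I -> H) y :
  inner (\sum_(i <- s) F i) y = \sum_(i <- s) inner (F i) y.
Proof. exact: (lin_sum (V := R[i]^o) (fun a x x' => innerPl a x x' y)). Qed.

Lemma inner_sumr H (I : Type) (s : seq I) (F : I -> H) x :
  inner x (\sum_(i <- s) F i) = \sum_(i <- s) inner x (F i).
Proof.
rewrite inner_conj inner_suml rmorph_sum; apply: eq_bigr => i _.
by rewrite [RHS]inner_conj.
Qed.

Lemma rnormD_orthogonal H (x y : H) :
  inner x y = 0 -> rnorm (x + y) ^+ 2 = rnorm x ^+ 2 + rnorm y ^+ 2.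
Proof.
move=> /normD_orthogonal; rewrite !rnormE => xy; apply: complexI.
by rewrite rmorphD !rmorphXn.
Qed.

Lemma rnorm_multiplicative H K T (t : H -> K -> T) x y :
  inner_multiplicative t -> rnorm (t x y) = rnorm x * rnorm y.
Proof.
move=> tm; have p0 : 0 <= rnorm x * rnorm y by rewrite mulr_ge0 ?rnorm_ge0.
apply/eqP; rewrite -(@eqrXn2 _ 2) ?rnorm_ge0 //; apply/eqP.
by rewrite -rnorm_sqr tm !innerxx !rnormE -!rmorphXn -rmorphM /= exprMn.
Qed.

(** All the second components along [p.2] are collected in a single elementary
tensor; the remaining ones are orthogonal to [p.2], so that this tensor is
orthogonal to the remaining sum when [t] multiplies inner products. *)
Lemma sum_bilinear_split H K T (t : H -> K -> T) (p : H * K) (s : seq (H * K)) :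
  (forall y, linear (t^~ y)) -> (forall x, linear (t x)) ->
  \sum_(q <- p :: s) t q.1 q.2 =
  t (p.1 + \sum_(q <- s) proj_coef q.2 p.2 *: q.1) p.2 +
  \sum_(q <- s) t q.1 (proj_rest q.2 p.2).
Proof.
move=> tl tr; rewrite big_cons (linD (tl _)) -addrA; congr (_ + _).
rewrite (lin_sum (tl _)) -big_split; apply: eq_bigr => q _ /=.
by rewrite (linZ (tl _)) -(linZ (tr _)) -(linD (tr _)) -proj_split.
Qed.

(** The norm of [f (x) id] is at most that of [f].  The splitting above writes
both sums as orthogonal sums, of an elementary tensor on which the bound is
that of [f] and of a sum with one term less. *)
Lemma ampliation_bound H H' K T T' (t : H -> K -> T) (t' : H' -> K -> T')
    (f : H -> H') (k : R) :
  inner_multiplicative t -> inner_multiplicative t' ->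
  linear f -> 0 <= k -> (forall x, rnorm (f x) <= k * rnorm x) ->
  forall s : seq (H * K),
  rnorm (\sum_(q <- s) t' (f q.1) q.2) <= k * rnorm (\sum_(q <- s) t q.1 q.2).
Proof.
move=> tm tm' lf k0 fk s; have [n] := ubnP (size s); elim: n s => // n IHn.
case=> [|p s] /= sn; first by rewrite !big_nil !rnorm0 mulr0.
have tl y := inner_multiplicative_linear y tm.
have tl' y := inner_multiplicative_linear y tm'.
have tr x := inner_multiplicative_linear x (inner_multiplicative_flip tm).
have tr' x := inner_multiplicative_linear x (inner_multiplicative_flip tm').
rewrite (sum_bilinear_split p s tl tr).
rewrite (@sum_bilinear_split _ _ _ (fun x y => t' (f x) y)) //=; last first.
  by move=> y a x x'; rewrite lf tl'.
set X := p.1 + _.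
have := IHn [seq (q.1, proj_rest q.2 p.2) | q <- s].
rewrite size_map !big_map /= => /(_ sn) IH.
rewrite -(@ler_pXn2r _ 2) ?nnegrE ?mulr_ge0 ?rnorm_ge0 // exprMn.
have rest0 q : inner p.2 (proj_rest q p.2) = 0.
  by rewrite inner_conj inner_proj_rest conjc0.
rewrite !rnormD_orthogonal; try by
  rewrite inner_sumr big1 // => q _; rewrite ?tm ?tm' rest0 mulr0.
rewrite (rnorm_multiplicative _ _ tm) (rnorm_multiplicative _ _ tm').
rewrite mulrDr lerD //.
  rewrite -exprMn ler_pXn2r ?nnegrE ?mulr_ge0 ?rnorm_ge0 //.
  by rewrite mulrA ler_wpM2r ?rnorm_ge0.
by rewrite -exprMn ler_pXn2r ?nnegrE ?mulr_ge0 ?rnorm_ge0.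
Qed.

Lemma ampliation_exists H H' K T T' (t : H -> K -> T) (t' : H' -> K -> T')
    (f : H -> H') :
  inner_multiplicative t -> inner_multiplicative t' -> bounded_linear f ->
  (forall w d, 0 < d ->
    exists s : seq (H * K), rnorm (w - \sum_(q <- s) t q.1 q.2) < d) ->
  exists h : T -> T', bounded_linear h /\ forall x y, h (t x y) = t' (f x) y.
Proof.
move=> tm tm' bf t_total; have [k k0 fk] := bounded_linear_rnorm bf.
have lf := bf.1.
have tl y := inner_multiplicative_linear y tm.
have tl' y := inner_multiplicative_linear y tm'.
have [|||h [hb hE]] := @bounded_extension _ T T' (H * K)%type
    (fun q => t q.1 q.2) (fun q => t' (f q.1) q.2) k k0.
- move=> a q; exists (a *: q.1, q.2) => /=.
  by rewrite (linZ lf) (linZ (tl _)) (linZ (tl' _)).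
- exact: (ampliation_bound tm tm' lf (ltW k0) fk).
- by move=> w d; exact: t_total.
by exists h; split => // x y; exact: (hE (x, y)).
Qed.

End Multiplicative.

Section Tensor.
Variable R : realType.
Implicit Types H K L : hilbertType R.

Lemma tens_multiplicative H K (T : hilbertTensor H K) :
  inner_multiplicative (tens T).
Proof. exact: inner_tens. Qed.

Lemma tens_approx H K (T : hilbertTensor H K) (w : T) d : 0 < d ->
  exists s : seq (H * K), rnorm (w - \sum_(q <- s) tens T q.1 q.2) < d.
Proof.
move=> d0; have d0' : 0 < d%:C by rewrite ltcR.
have [] := @tens_total _ _ _ T (ball w d%:C)° _ (@open_interior _ _).
  by exists w; apply: nbhsx_ballx.
move=> z [/interior_subset wz [n [x [y zE]]]]; rewrite zE in wz.
exists [seq (x i, y i) | i <- index_enum 'I_n]; rewrite big_map.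
by apply/ball_rnorm.
Qed.

Lemma tens_ext H K (T : hilbertTensor H K) (phi : T -> R[i]) (k : R) :
  (forall a w w', phi (a *: w + w') = a * phi w + phi w') ->
  (forall w, rnorm (phi w) <= k * rnorm w) ->
  (forall x y, phi (tens T x y) = 0) -> forall w, phi w = 0.
Proof.
move=> lphi phik phi0 w; apply/rnorm0_eq0/le_anti; rewrite rnorm_ge0 andbT.
apply/ler_addgt0Pr => d d0; rewrite add0r.
have k1 : 0 < `|k| + 1 by rewrite ltr_wpDl.
have [|s ws] := @tens_approx _ _ T w (d / (`|k| + 1)).
  by rewrite divr_gt0.
have lphi' : linear (phi : T -> R[i]^o) by exact: lphi.
have -> : phi w = phi (w - \sum_(q <- s) tens T q.1 q.2).
  rewrite (linB lphi') (lin_sum lphi') big1 ?subr0 // => q _; exact: phi0.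
apply: le_trans (phik _) _; rewrite ltr_pdivlMr // in ws.
apply: le_trans (ltW ws); rewrite mulrC ler_wpM2l ?rnorm_ge0 //.
by rewrite (le_trans (ler_norm _)) // lerDl.
Qed.

Lemma tensor_map_fstP H H' K (T : hilbertTensor H K) (T' : hilbertTensor H' K)
    (f : H -> H') : bounded_linear f ->
  bounded_linear (tensor_map T T' f (@id K)) /\
  forall x y, tensor_map T T' f (@id K) (tens T x y) = tens T' (f x) y.
Proof.
move=> bf; apply: (@getPex _ [set h : T -> T' |
  bounded_linear h /\ forall x y, h (tens T x y) = tens T' (f x) y]).
apply: ampliation_exists => //; try exact: tens_multiplicative.
exact: tens_approx.
Qed.

Lemma tensor_map_sndP H K K' (T : hilbertTensor H K) (T' : hilbertTensor H K')
    (g : K -> K') : bounded_linear g ->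
  bounded_linear (tensor_map T T' (@id H) g) /\
  forall x y, tensor_map T T' (@id H) g (tens T x y) = tens T' x (g y).
Proof.
move=> bg; apply: (@getPex _ [set h : T -> T' |
  bounded_linear h /\ forall x y, h (tens T x y) = tens T' x (g y)]).
have tm := inner_multiplicative_flip (tens_multiplicative T).
have tm' := inner_multiplicative_flip (tens_multiplicative T').
have [w d d0|h [hb hE]] := ampliation_exists tm tm' bg.
  have [s ws] := tens_approx w d0; exists [seq (q.2, q.1) | q <- s].
  by rewrite big_map.
by exists h; split.
Qed.

Section Associator.
Variables (H K L : hilbertType R).
Variables (HK : hilbertTensor H K) (KL : hilbertTensor K L).
Variables (T : hilbertTensor HK L) (T' : hilbertTensor H KL).

Let e (p : H * K * L) : T := tens T (tens HK p.1.1 p.1.2) p.2.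
Let b (p : H * K * L) : T' := tens T' p.1.1 (tens KL p.1.2 p.2).

(** Each first component of an approximating sum in [T] is itself approximated
by elementary tensors, to a precision scaled by the second component. *)
Lemma triple_tens_approx (w : T) d : 0 < d ->
  exists s : seq (H * K * L), rnorm (w - \sum_(p <- s) e p) < d.
Proof.
move=> d0; have d20 : 0 < d / 2 by rewrite divr_gt0.
have tl y := inner_multiplicative_linear y (tens_multiplicative T).
have refine_sum (s2 : seq (HK * L)) c : 0 < c -> exists s : seq (H * K * L),
    rnorm (\sum_(q <- s2) tens T q.1 q.2 - \sum_(p <- s) e p) < c.
  elim: s2 c => [|q s2 IH] c c0.
    by exists [::]; rewrite !big_nil subrr rnorm0.
  have c20 : 0 < c / 2 by rewrite divr_gt0.
  have q0 : 0 < rnorm q.2 + 1 by rewrite ltr_wpDl ?rnorm_ge0.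
  have [s ss2] := IH _ c20.
  have [|s1 s1q] := @tens_approx _ _ HK q.1 (c / 2 / (rnorm q.2 + 1)).
    by rewrite divr_gt0.
  exists ([seq (p, q.2) | p <- s1] ++ s).
  rewrite big_cons big_cat big_map /= opprD addrACA (splitr c).
  apply: le_lt_trans (rnormD _ _) _; apply: ltrD => //.
  rewrite /e /= -(lin_sum (tl _)) -(linB (tl _)).
  rewrite (rnorm_multiplicative _ _ (tens_multiplicative T)).
  rewrite ltr_pdivlMr // in s1q; apply: le_lt_trans s1q.
  by rewrite ler_wpM2l ?rnorm_ge0 // lerDl.
have [s2 ws2] := tens_approx w d20; have [s s2s] := refine_sum s2 _ d20.
exists s; rewrite -(subrK (\sum_(q <- s2) tens T q.1 q.2) w) -addrA (splitr d).
by apply: le_lt_trans (rnormD _ _) _; apply: ltrD.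
Qed.

Lemma tensor_assocP : bounded_linear (tensor_assoc T T') /\
  forall x y z,
    tensor_assoc T T' (tens T (tens HK x y) z) = tens T' x (tens KL y z).
Proof.
apply: (@getPex _ [set a : T -> T' | bounded_linear a /\
    forall x y z, a (tens T (tens HK x y) z) = tens T' x (tens KL y z)]).
have [|||h [hb hE]] := @bounded_extension _ T T' (H * K * L)%type e b 1 ltr01.
- move=> a [[x y] z]; exists (a *: x, y, z); rewrite /e /b /=.
  have t1 v := inner_multiplicative_linear v (tens_multiplicative T).
  have t2 v := inner_multiplicative_linear v (tens_multiplicative HK).
  have t3 v := inner_multiplicative_linear v (tens_multiplicative T').
  by rewrite (linZ (t2 _)) (linZ (t1 _)) (linZ (t3 _)).
- move=> s; rewrite mul1r -(@ler_pXn2r _ 2) ?nnegrE ?rnorm_ge0 // -!rnorm_sqr.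
  have -> // : inner (\sum_(p <- s) b p) (\sum_(p <- s) b p)
             = inner (\sum_(p <- s) e p) (\sum_(p <- s) e p).
  rewrite !inner_suml; apply: eq_bigr => p _; rewrite !inner_sumr.
  by apply: eq_bigr => q _; rewrite !inner_tens mulrA.
- by move=> w d; exact: triple_tens_approx.
by exists h; split => // x y z; exact: (hE (x, y, z)).
Qed.

End Associator.

End Tensor.

(** * Adjoints of multiplications in a Frobenius algebra *)

Section BoundedMaps.
Variable R : realType.
Implicit Types H K L : hilbertType R.

Lemma bounded_linear_comp H K L (g : K -> L) (f : H -> K) :
  bounded_linear g -> bounded_linear f -> bounded_linear (g \o f).
Proof.
move=> bg bf; have [k k0 fk] := bounded_linear_rnorm bf.
have [l l0 gl] := bounded_linear_rnorm bg.
apply: (@rnorm_bounded_linear _ _ _ _ (l * k)) => [a x y|x] /=.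
  by rewrite bf.1 bg.1.
by rewrite -mulrA (le_trans (gl _)) // ler_pM2l.
Qed.

Lemma bounded_linear_tensl H K (T : hilbertTensor H K) y :
  bounded_linear (fun x => tens T x y).
Proof.
apply: (@rnorm_bounded_linear _ _ _ _ (rnorm y)).
  exact: inner_multiplicative_linear (tens_multiplicative T).
by move=> x; rewrite (rnorm_multiplicative _ _ (tens_multiplicative T)) mulrC.
Qed.

Lemma bounded_linear_tensr H K (T : hilbertTensor H K) x :
  bounded_linear (tens T x).
Proof.
apply: (@rnorm_bounded_linear _ _ _ _ (rnorm x)).
  exact: inner_multiplicative_linear
    (inner_multiplicative_flip (tens_multiplicative T)).
by move=> y; rewrite (rnorm_multiplicative _ _ (tens_multiplicative T)).
Qed.

(** An adjunction-like identity between bounded maps may be checked on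
elementary tensors, by density. *)
Lemma tens_inner_ext H K L (T : hilbertTensor H K) (F : T -> L) c d :
  bounded_linear F ->
  (forall x y, inner (F (tens T x y)) c = inner (tens T x y) d) ->
  forall w, inner (F w) c = inner w d.
Proof.
move=> bF E w; have [k k0 Fk] := bounded_linear_rnorm bF.
apply/eqP; rewrite -subr_eq0; apply/eqP.
apply: (@tens_ext _ _ _ T (fun w => inner (F w) c - inner w d)
  (k * rnorm c + rnorm d)) => [a u v|u|x y]; last by rewrite E subrr.
  by rewrite bF.1 !innerPl; ring.
rewrite -[inner (F u) c - _]/(inner (F u) c + _).
apply: le_trans (rnormD _ _) _; rewrite mulrDl lerD //.
  apply: le_trans (rnorm_inner _ _) _.
  by rewrite mulrAC ler_wpM2r ?rnorm_ge0.
by rewrite /rnorm normrN -/(rnorm _) mulrC; exact: rnorm_inner.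
Qed.

End BoundedMaps.

Section Algebra.
Variables (R : realType) (H : hilbertType R) (HH : hilbertTensor H H).
Variable mu : HH -> H.
Hypothesis Amu : hilbertian_algebra mu.

Local Notation "x ** y" := (hmul mu x y) (at level 40, left associativity).
Local Notation adjM y := (adjoint (hmul mu y)).

Let bmu : bounded_linear mu := hmul_bounded Amu.
Let mulA : associative (hmul mu) := hmulA Amu.
Let mulC : commutative (hmul mu) := hmulC Amu.

Lemma hmul_boundedr u : bounded_linear (hmul mu u).
Proof. exact: bounded_linear_comp bmu (bounded_linear_tensr HH u). Qed.

Lemma hmul_boundedl u : bounded_linear (fun v => v ** u).
Proof. exact: bounded_linear_comp bmu (bounded_linear_tensl HH u). Qed.

Lemma adjMP y u v : inner (y ** u) v = inner u (adjM y v).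
Proof. by have [_ ->] := adjointP (hmul_boundedr y). Qed.

(** [<x, M_y^dag (u z)> = <delta (x y), u (x) z> = <x, u (M_y^dag z)>], where
the second equality is the Frobenius equation at [x (x) y]. *)
Lemma frobenius_adjM (HHl : hilbertTensor HH H) (HHr : hilbertTensor H HH) :
  hilbertian_frobenius_algebra mu HHl HHr ->
  forall u y z, adjM y (u ** z) = u ** adjM y z.
Proof.
move=> [_ _ frob] u y z; have [bdelta deltaP] := adjointP bmu.
have [b1 E1] := tensor_map_fstP HH HHl bdelta.
have [b2 E2] := tensor_assocP HHl HHr.
have [b3 E3] := tensor_map_sndP HHr HH bmu.
(* [F] is [id (x) M_y], expressed through the associator. *)
pose F w := tensor_map HHr HH (@id H) mu
  (tensor_assoc HHl HHr (tens HHl w y)).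
have pairing w : inner (F w) (tens HH u z) = inner w (tens HH u (adjM y z)).
  move: w; apply: tens_inner_ext.
    have b21 := bounded_linear_comp b2 (bounded_linear_tensl HHl y).
    exact: bounded_linear_comp b3 b21.
  move=> a b; rewrite /F E2 E3 !inner_tens; congr (_ * _).
  by rewrite -adjMP mulC.
apply: inner_eqr => x; rewrite -adjMP [y ** x]mulC.
have /= := congr1 (fun f => f (tens HH x y)) frob; rewrite E1 -/(F _).
move=> delta_xy; rewrite inner_conj deltaP delta_xy -inner_conj pairing.
by rewrite inner_conj -deltaP -inner_conj.
Qed.

(** * The radical of a Frobenius algebra *)

Lemma radical_mul x y : jacobson_radical mu y -> jacobson_radical mu (x ** y).
Proof.
move=> Jy I mI; have [[idI _] _ _] := mI.
exact: ideal_mul idI _ _ (Jy _ mI).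
Qed.

Lemma radical_scale a y : jacobson_radical mu y -> jacobson_radical mu (a *: y).
Proof.
move=> Jy I mI; have [[idI _] _ _] := mI; rewrite -[a *: y]addr0.
by apply: ideal_linear idI _ _ _ (Jy _ mI) (ideal0 idI).
Qed.

Lemma annihilator_radical : annihilator mu `<=` jacobson_radical mu.
Proof.
move=> u Au I [[_ [e eI]] _ _]; have := eI u.
by rewrite mulC Au subr0.
Qed.

(** Otherwise the ideal [L] of all [a - x a], modular with identity [x], does
not contain [x].  An ideal containing [L] is proper iff it misses [x], so an
ideal maximal among those missing [x] is a maximal modular ideal without [x]. *)
Lemma radical_quasiregular x :
  jacobson_radical mu x -> exists a, a - x ** a = x.
Proof.
move=> Jx; apply: contrapT => noq.
have lx := (hmul_boundedr x).1.
pose L := range (fun a => a - x ** a).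
have nLx : ~ L x by move=> [a _ ax]; apply: noq; exists a.
have idL : algebra_ideal mu L.
  split; first by exists 0; rewrite // (lin0 lx) subr0.
  - move=> a _ _ [b _ <-] [c _ <-]; exists (a *: b + c) => //.
    by rewrite lx scalerBr opprD addrACA.
  - move=> y _ [b _ <-]; exists (y ** b) => //.
    by rewrite (linB (hmul_boundedr y).1) !mulA (mulC x y).
(* The empty set is admitted since it is the union of the empty chain. *)
pose P I := I = set0 \/ [/\ algebra_ideal mu I, L `<=` I & ~ I x].
have [F FP totF|M [PM maxM]] := @Zorn_bigcup _ P.
  have [F0|] := pselect (forall X, F X -> X = set0).
    by left; apply/seteqP; split => // y [X /F0 ->].
  move=> /existsNP[X0 /not_implyP[FX0 X0n]].
  have good X : F X -> X <> set0 -> [/\ algebra_ideal mu X, L `<=` X & ~ X x].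
    by move=> /FP[].
  have ne (X : set H) y : X y -> X <> set0 by move=> Xy X0'; rewrite X0' in Xy.
  have [id0 LX0 _] := good _ FX0 X0n; right; split.
  - split; first by exists X0 => //; exact: ideal0 id0.
    + move=> a y z [X FX Xy] [Y FY Yz].
      have [idX _ _] := good _ FX (ne _ _ Xy).
      have [idY _ _] := good _ FY (ne _ _ Yz).
      have [XY|YX] := totF _ _ FX FY.
        by exists Y => //; apply: ideal_linear idY _ _ _ (XY _ Xy) Yz.
      by exists X => //; apply: ideal_linear idX _ _ _ Xy (YX _ Yz).
    + move=> y z [X FX Xz]; have [idX _ _] := good _ FX (ne _ _ Xz).
      by exists X => //; apply: ideal_mul idX _ _ Xz.
  - by move=> y /LX0 X0y; exists X0.
  - by move=> [X FX Xx]; have [_ _] := good _ FX (ne _ _ Xx); exact.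
have M0 : M <> set0.
  move=> ME; apply: (maxM L); last by right; split.
  split; first by rewrite ME.
  by rewrite ME => /(_ 0 (ideal0 idL)).
have [/M0 []|[idM LM nMx]] := PM.
apply/nMx/(Jx M); split; last 1 first.
- move=> K idK MK; have [Kx|nKx] := pselect (K x); last first.
    left; apply: contrapT => KM; apply: (maxM K); last first.
      by right; split => //; exact: subset_trans LM MK.
    by split => // sKM; apply: KM; apply/seteqP.
  right; apply/seteqP; split => // a _.
  rewrite -(subrK (x ** a) a) -[a - _]scale1r.
  apply: (ideal_linear idK); first by apply/MK/LM; exists a.
  by rewrite mulC; exact: (ideal_mul idK).
- by split => //; exists x => a; apply: LM; exists a.
- by move=> MT; apply: nMx; rewrite MT.
Qed.

(** If [a - q a = q] then [1 + M_a] is inverse to [1 - M_q]. *)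
Lemma radical_bounded_below q : jacobson_radical mu q ->
  exists2 k : R, 1 <= k & forall v, rnorm v <= k * rnorm (v - q ** v).
Proof.
move=> /radical_quasiregular[a aE].
have [k k0 ak] := bounded_linear_rnorm (hmul_boundedr a).
exists (1 + k) => [|v]; first by rewrite lerDl ltW.
have -> : rnorm v = rnorm ((v - q ** v) + a ** (v - q ** v)).
  congr rnorm; rewrite (linB (hmul_boundedr a).1) mulA (mulC a q).
  by rewrite -(linB (hmul_boundedl v).1) aE subrK.
apply: le_trans (rnormD _ _) _.
by rewrite mulrDl mul1r lerD2l.
Qed.

Section AdjointModuleMap.
Hypothesis adjM_mul : forall u y z, adjM y (u ** z) = u ** adjM y z.

Lemma hmul_normal u : normal_operator (hmul mu u).
Proof.
by split; [exact: hmul_boundedr|apply/funext => v /=; rewrite adjM_mul].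
Qed.

(** An elementary form of the fact that the norm of a positive operator belongs
to its spectrum.  For the best constant [c] in [|p v|^2 <= c |v|^2],
[|v - c^-1 p p v|^2 <= |v|^2 - c^-1 |p v|^2].  The left side is bounded below
by [K^-2 |v|^2], which improves [c] to [c (1 - K^-2)]. *)
Lemma radical_selfadjoint_sqr p :
  (forall v w, inner (p ** v) w = inner v (p ** w)) ->
  jacobson_radical mu (p ** p) -> forall v, p ** v = 0.
Proof.
move=> psa Jpp; have [k k0 pk] := bounded_linear_rnorm (hmul_boundedr p).
pose C := [set c : R |
  0 <= c /\ forall v, rnorm (p ** v) ^+ 2 <= c * rnorm v ^+ 2].
have Cinf : has_inf C.
  split; last by exists 0 => c [].
  exists (k ^+ 2); split => [|v]; first exact: sqr_ge0.
  by rewrite -exprMn ler_pXn2r ?nnegrE ?mulr_ge0 ?rnorm_ge0 // ltW.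
set c := inf C.
have c0 : 0 <= c by apply: lb_le_inf; [exact: Cinf.1|move=> ? []].
have cP v : rnorm (p ** v) ^+ 2 <= c * rnorm v ^+ 2.
  have [v0|v0] := eqVneq (rnorm v) 0.
    have := pk v; rewrite v0 mulr0 => pv0.
    have {}pv0 : rnorm (p ** v) = 0 by apply/le_anti; rewrite pv0 rnorm_ge0.
    by rewrite pv0 expr0n mulr0.
  have vv0 : 0 < rnorm v ^+ 2 by rewrite exprn_gt0 // lt_def v0 rnorm_ge0.
  rewrite -ler_pdivrMr //; apply: lb_le_inf; first exact: Cinf.1.
  by move=> d [_ dP]; rewrite ler_pdivrMr.
have [c_eq0|c_neq0] := eqVneq c 0.
  move=> v; apply/rnorm0_eq0/eqP; rewrite -sqrf_eq0; apply/eqP/le_anti.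
  by rewrite sqr_ge0 andbT; have := cP v; rewrite c_eq0 mul0r.
have {c_neq0}c0 : 0 < c by rewrite lt_def c_neq0.
have [K K1 KP] := radical_bounded_below (radical_scale (c^-1)%:C Jpp).
have K0 : 0 < K ^+ 2 by rewrite exprn_gt0 // (lt_le_trans ltr01).
suff : C (c * (1 - (K ^+ 2)^-1)).
  by move/(ge_inf Cinf.2); rewrite -/c leNgt gtr_pMr // gtrBl invr_gt0 K0.
split=> [|v].
  by rewrite mulr_ge0 ?(ltW c0) // subr_ge0 invf_le1 // exprn_ege1.
set P := rnorm (p ** v) ^+ 2; set N := rnorm v ^+ 2.
have below : N <= K ^+ 2 * (N - c^-1 * P).
  have := KP v; rewrite -(@ler_pXn2r _ 2) ?nnegrE ?mulr_ge0 ?rnorm_ge0 //;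
    last by rewrite (le_trans ler01).
  move/le_trans; apply; rewrite exprMn ler_pM2l //.
  rewrite (linZ (hmul_boundedl v).1) -mulA -scaleNr -rmorphN rnorm_sqrD_scale.
  rewrite -psa rnorm_sqr -/N -/P; have := cP (p ** v); rewrite -/P sqrrN.
  rewrite -ler_pdivrMl // => PE; set Q := rnorm _ ^+ 2 in PE *.
  have cv0 : 0 <= c^-1 by rewrite invr_ge0 ltW.
  have := ler_wpM2l cv0 PE; rewrite mulrA -expr2; lra.
have cc : c * c^-1 = 1 by rewrite mulfV // gt_eqF.
have -> : P = c * (c^-1 * P) by rewrite mulrA cc mul1r.
rewrite -mulrA ler_pM2l //; move: below; rewrite -ler_pdivrMl //; lra.
Qed.

(** With [p = M_x^dag x], [<p v, w> = <x v, x w>]: so [p] is self-adjoint, and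
[p v = 0] forces [x v = 0]. *)
Lemma radical_annihilator : jacobson_radical mu `<=` annihilator mu.
Proof.
move=> x Jx; set p := adjM x x.
have pE v : p ** v = adjM x (x ** v) by rewrite [x ** v]mulC adjM_mul mulC.
have pinner v w : inner (p ** v) w = inner (x ** v) (x ** w).
  by rewrite pE inner_conj -adjMP -inner_conj.
have psa v w : inner (p ** v) w = inner v (p ** w).
  by rewrite [RHS]inner_conj !pinner -inner_conj.
have Jpp : jacobson_radical mu (p ** p).
  (* [p p = M_x^dag (x p) = x (M_x^dag p)] *)
  by rewrite pE adjM_mul mulC; apply: radical_mul.
move=> v; apply: inner_eq0; rewrite -pinner.
by rewrite (radical_selfadjoint_sqr psa Jpp) inner_conj inner0r conjc0.
Qed.

End AdjointModuleMap.
End Algebra.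

Theorem proposition29 (R : realType) (H : hilbertType R)
    (HH : hilbertTensor H H) (HHl : hilbertTensor HH H)
    (HHr : hilbertTensor H HH) (mu : HH -> H)
    (Hmu : hilbertian_frobenius_algebra mu HHl HHr) :
  (forall u : H, normal_operator (hmul mu u)) /\
  jacobson_radical mu = annihilator mu.
Proof.
have Amu := frobenius_algebra Hmu; have adjM_mul := frobenius_adjM Amu Hmu.
split=> [u|]; first exact: hmul_normal.
apply/seteqP; split; first exact: radical_annihilator.
exact: annihilator_radical.
Qed.
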